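(* For every fixed $d>0$ there exists a constant $c(d)>0$, depending only on $d$, such that for all $a,b\ge 1$, with $p:=a/(a+b)$, $\sigma_{a,b}:=\sqrt{p(1-p)/(a+b+1)}$ and $X\sim\mathrm{Beta}(a,b)$, \[ P(X-p\ge\varepsilon)\ \le\ \exp\Bigl(-\frac{(a+b+d)\,\varepsilon^2}{2(p+2\varepsilon/3)(1-p-2\varepsilon/3)^+}\Bigr) \] whenever $\varepsilon\ge c(d)\,\sigma_{a,b}$.
   Context: $\mathrm{Beta}(a,b)$ is the beta distribution with density proportional to $x^{a-1}(1-x)^{b-1}$ on $(0,1)$; $s^+:=\max\{s,0\}$. When $(1-p-2\varepsilon/3)^+=0$, the fraction in the exponent is interpreted as $+\infty$, so the right-hand side is $0$. *)

(* Defs.v *)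
From HB Require Import structures.
From mathcomp Require Import all_boot all_order all_algebra.
From mathcomp Require Import all_classical all_reals all_analysis.

Set Implicit Arguments.
Unset Strict Implicit.
Unset Printing Implicit Defensive.

Import Order.TTheory GRing.Theory Num.Theory.
Import numFieldNormedType.Exports.

Local Open Scope classical_set_scope.
Local Open Scope ring_scope.

(** [beta_prob] in [beta_distribution] only covers natural-number parameters;
    here [a] and [b] are real. *)

Definition rbeta_weight {R : realType} (a b x : R) : R :=
  x `^ (a - 1) * (1 - x) `^ (b - 1).

Definition rbeta_fun {R : realType} (a b : R) : R :=
  \int[lebesgue_measure]_(x in `]0, 1[) rbeta_weight a b x.

Definition rbeta_pdf {R : realType} (a b : R) : R -> R :=
  (fun x => rbeta_weight a b x / rbeta_fun a b) \_ `]0, 1[.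

Definition rbeta_prob {R : realType} (a b : R) (U : set R) : \bar R :=
  (\int[lebesgue_measure]_(x in U) (rbeta_pdf a b x)%:E)%E.

Definition has_beta_distribution {R : realType} {disp : measure_display}
    {T : measurableType disp} (P : probability T R) (X : {RV P >-> R})
    (a b : R) : Prop :=
  forall U : set R, measurable U -> distribution P X U = rbeta_prob a b U.

Definition beta_mean {R : realType} (a b : R) : R := a / (a + b).

Definition beta_stddev {R : realType} (a b : R) : R :=
  let p := beta_mean a b in Num.sqrt (p * (1 - p) / (a + b + 1)).

Definition pos_part {R : realType} (s : R) : R := Num.max s 0.

Arguments has_beta_distribution {R disp T} P X a b.

(* Main.v *)
Require Import Defs.
From HB Require Import structures.
From mathcomp Require Import all_boot all_order all_algebra.
From mathcomp Require Import all_classical all_reals all_analysis.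
From mathcomp Require Import measurable_realfun ring lra.

Set Implicit Arguments.
Unset Strict Implicit.
Unset Printing Implicit Defensive.

Import Order.TTheory GRing.Theory Num.Theory.
Import numFieldNormedType.Exports.

Local Open Scope classical_set_scope.
Local Open Scope ring_scope.

(** Write [n = a + b], [a = n p], [b = n (1 - p)], let [sigma] be the standard
    deviation of Beta([a], [b]) and let [w(x) = x^a (1 - x)^b], so that the
    density of Beta([a], [b]) is [w(x) / (B x (1 - x))], with [B] the beta
    integral.

    The kernel [w] peaks at the mean [p], and expanding the two logarithms in
    [ln w(p + u) - ln w(p)] with the Pade-type bound [ln_le_pade] gives exactly
    the Bernstein exponent with [n] in place of [n + d]:
    [w(p + u) <= w(p) exp (- n h(u))], where
    [h(u) = u^2 / (2 (p + 2u/3) (1 - p - 2u/3))] ([beta_kernel_le]).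

    The passage from [n] to [n + d] costs only a constant factor: for
    [u < 1 - p] both factors in the denominator of [h] are bounded below by
    multiples of [u], so [h(u) <= 9/4] and [exp (- d h(u)) >= exp (- 9d/4)].
    This constant is gained as in Mills' inequality for Gaussian tails. Since
    [- w'(x) = n (x - p) x^(a-1) (1 - x)^(b-1)], the tail integral of the
    density beyond [p + u] is at most [w(p + u) / (n u B)]
    ([integral_beta_tail_le]). An elementary form of Stirling's lower bound,
    [B >= w(p) / (16 e n sigma)] ([rbeta_fun_ge_stddev]), follows by
    integrating [w(x) / (x (1 - x))] over an interval of length of order [sigma]
    to the right of [p], where [w] stays within a constant factor of its
    maximum.
    Hence ([rbeta_prob_tail_le])
    [P (X >= p + u) <= (16 e sigma / u) exp (- n h(u))],
    and the prefactor is at most [exp (- 9d/4)] as soon as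
    [u >= 16 exp (1 + 9d/4) sigma]. *)

(** * Two bounds for the logarithm *)

(** The difference of the two sides vanishes at [1] and its derivative
    [4 (w - 1)^3 / ((4 w + 2)^2 w)] has the sign of [w - 1]. With
    [w = 1 + z] the bound reads [ln (1 + z) <= z - z^2 / (2 (1 + 2z/3))], which
    is where the fractions [2/3] of the Bernstein exponent come from. *)
Lemma ln_le_pade (R : realType) (w : R) : 0 < w ->
  ln w <= (w - 1) * (w + 5) / (4 * w + 2).
Proof.
move=> w0.
pose D (x : R) := (x - 1) * (x + 5) / (4 * x + 2) - ln x.
pose dD (x : R) := 4 * (x - 1) ^+ 3 / ((4 * x + 2) ^+ 2 * x).
have D1 : D 1 = 0 by rewrite /D ln1 subrr !mul0r subr0.
have dDE (x : R) : 0 < x -> is_derive x 1 D (dD x).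
  move=> x0.
  have x42 : 4 * x + 2 != 0 :> R by apply: lt0r_neq0; lra.
  have dln := is_derive1_ln x0.
  have dlin : is_derive x 1 (fun x : R => 4 * x + 2 : R) (4 : R).
    apply: is_derive_eq; rewrite /GRing.scale/=; ring.
  have dinv := is_deriveV x42.
  apply: is_derive_eq; rewrite /GRing.scale/= /dD.
  by field; rewrite x42 lt0r_neq0.
have cD (x y : R) : 0 < x -> {within `[x, y], continuous D}.
  move=> x0; apply: derivable_within_continuous => z.
  by rewrite in_itv/= => /andP[xz _]; have [] := dDE z (lt_le_trans x0 xz).
suff : 0 <= D w by rewrite /D subr_ge0.
have [w1|w1|->] := ltgtP w 1; last by rewrite D1.
- have dDw (x : R) : x \in `]w, 1[ -> is_derive x 1 D (dD x).
    by rewrite in_itv/= => /andP[wx _]; apply: dDE; exact: lt_trans wx.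
  have [x] := MVT w1 dDw (cD _ _ w0).
  rewrite in_itv/= => /andP[wx x1]; rewrite D1 sub0r => /(canRL (@opprK _)) ->.
  rewrite oppr_ge0 pmulr_lle0 ?subr_gt0// /dD pmulr_lle0; last first.
    by rewrite invr_gt0 mulr_gt0 ?exprn_gt0//; lra.
  rewrite exprS mulrCA nmulr_rle0 ?subr_lt0//.
  by rewrite mulr_ge0 ?sqr_ge0.
- have dDw (x : R) : x \in `]1, w[ -> is_derive x 1 D (dD x).
    by rewrite in_itv/= => /andP[wx _]; apply: dDE; exact: lt_trans wx.
  have [x] := MVT w1 dDw (cD _ _ ltr01).
  rewrite in_itv/= => /andP[wx x1]; rewrite D1 subr0 => ->.
  rewrite mulr_ge0 ?subr_ge0 ?(ltW w1)// /dD divr_ge0//.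
    by rewrite mulr_ge0 ?exprn_ge0// subr_ge0 ltW.
  by rewrite mulr_ge0 ?sqr_ge0//; lra.
Qed.

Lemma ln_ge_onemV (R : realType) (w : R) : 0 < w -> 1 - w^-1 <= ln w.
Proof.
move=> w0; have iw0 : 0 < w^-1 by rewrite invr_gt0.
have := @le_ln1Dx R (w^-1 - 1); rewrite subrKC lnV ?posrE// => lnw.
have {}lnw : - ln w <= w^-1 - 1 by apply: lnw; lra.
lra.
Qed.

(** * The kernel of the beta density *)

(** The exponents are [a] and [b], not [a - 1] and [b - 1]: this function is
    maximal at the mean [a / (a + b)] of the beta distribution, and the density
    in general is not. *)
Definition beta_kernel {R : realType} (a b x : R) : R := x `^ a * (1 - x) `^ b.

Section beta_kernel.
Context {R : realType}.
Implicit Types (a b n p u x : R).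

Lemma beta_kernelE a b x : 0 < x < 1 ->
  beta_kernel a b x = expR (a * ln x + b * ln (1 - x)).
Proof.
move=> /andP[x0 x1]; rewrite /beta_kernel /powR.
by rewrite !gt_eqF ?subr_gt0// expRD.
Qed.

Lemma beta_kernel_gt0 a b x : 0 < x < 1 -> 0 < beta_kernel a b x.
Proof. by move=> x01; rewrite beta_kernelE// expR_gt0. Qed.

(** Applied to [(p + u) / p] and [(1 - p - u) / (1 - p)], the bound [ln_le_pade]
    produces linear terms that cancel, since the exponents are proportional to
    [p] and [1 - p]; the quadratic terms add up to the Bernstein exponent. *)
Lemma beta_kernel_le n p u : 0 < n -> 0 < p -> 0 <= u < 1 - p ->
  beta_kernel (n * p) (n * (1 - p)) (p + u) <=
  beta_kernel (n * p) (n * (1 - p)) p *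
  expR (- (n * u ^+ 2 / (2 * (p + 2 * u / 3) * (1 - p - 2 * u / 3)))).
Proof.
move=> n0 p0 /andP[u0 uq].
have np0 : 0 < n * p by rewrite mulr_gt0.
have nq0 : 0 < n * (1 - p) by rewrite mulr_gt0//; lra.
rewrite !beta_kernelE ?(p0)/=; [|lra..].
rewrite -expRD ler_expR.
have lnp : n * p * (ln (p + u) - ln p) <= n * u * (6 * p + u) / (6 * p + 4 * u).
  rewrite -ln_div ?posrE//; last lra.
  have w0 : 0 < (p + u) / p by rewrite divr_gt0//; lra.
  have := ln_le_pade w0; rewrite -(ler_pM2l np0) => /le_trans; apply.
  rewrite le_eqVlt; apply/orP; left; apply/eqP; field.
  by do ?[apply/andP; split]; apply: lt0r_neq0; lra.
have lnq : n * (1 - p) * (ln (1 - (p + u)) - ln (1 - p)) <=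
    - (n * u * (6 * (1 - p) - u) / (6 * (1 - p) - 4 * u)).
  rewrite -ln_div ?posrE//; [|lra..].
  have w0 : 0 < (1 - (p + u)) / (1 - p) by rewrite divr_gt0//; lra.
  have := ln_le_pade w0; rewrite -(ler_pM2l nq0) => /le_trans; apply.
  rewrite le_eqVlt; apply/orP; left; apply/eqP; field.
  by do ?[apply/andP; split]; apply: lt0r_neq0; lra.
have -> : - (n * u ^+ 2 / (2 * (p + 2 * u / 3) * (1 - p - 2 * u / 3))) =
   n * u * (6 * p + u) / (6 * p + 4 * u)
   - (n * u * (6 * (1 - p) - u) / (6 * (1 - p) - 4 * u)).
  by field; do ?[apply/andP; split]; apply: lt0r_neq0; lra.
lra.
Qed.

(** Near [p] the kernel is comparable to its maximum; this is what bounds the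
    beta integral from below. As in [beta_kernel_le], the linear terms of the
    two logarithms cancel. *)
Lemma beta_kernel_ge n p u : 0 < n -> 0 < p -> 0 <= u < 1 - p ->
  beta_kernel (n * p) (n * (1 - p)) p *
  expR (- (n * u ^+ 2 / ((p + u) * (1 - p - u)))) <=
  beta_kernel (n * p) (n * (1 - p)) (p + u).
Proof.
move=> n0 p0 /andP[u0 uq].
have np0 : 0 < n * p by rewrite mulr_gt0.
have nq0 : 0 < n * (1 - p) by rewrite mulr_gt0//; lra.
rewrite !beta_kernelE ?(p0)/=; [|lra..].
rewrite -expRD ler_expR.
have lnp : n * p * u / (p + u) <= n * p * (ln (p + u) - ln p).
  rewrite -ln_div ?posrE//; last lra.
  have w0 : 0 < (p + u) / p by rewrite divr_gt0//; lra.
  have := ln_ge_onemV w0; rewrite -(ler_pM2l np0); apply: le_trans.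
  rewrite le_eqVlt; apply/orP; left; apply/eqP; field.
  by do ?[apply/andP; split]; apply: lt0r_neq0; lra.
have lnq : - (n * (1 - p) * u / (1 - p - u)) <=
    n * (1 - p) * (ln (1 - (p + u)) - ln (1 - p)).
  rewrite -ln_div ?posrE//; [|lra..].
  have w0 : 0 < (1 - (p + u)) / (1 - p) by rewrite divr_gt0//; lra.
  have := ln_ge_onemV w0; rewrite -(ler_pM2l nq0); apply: le_trans.
  rewrite le_eqVlt; apply/orP; left; apply/eqP; field.
  by do ?[apply/andP; split]; apply: lt0r_neq0; lra.
have -> : - (n * u ^+ 2 / ((p + u) * (1 - p - u))) =
   n * p * u / (p + u) - n * (1 - p) * u / (1 - p - u).
  by field; do ?[apply/andP; split]; apply: lt0r_neq0; lra.
lra.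
Qed.

End beta_kernel.

(** * Tail integral of the beta weight *)

Section beta_tail.
Context {R : realType}.
Implicit Types (a b x y : R).
Local Notation mu := (@lebesgue_measure R).

Lemma continuous_powR a x : 0 < x -> {for x, continuous (fun z : R => z `^ a)}.
Proof.
move=> x0; apply/differentiable_continuous/derivable1_diffP.
by have [] := is_derive1_powR a x0.
Qed.

Lemma is_derive_beta_kernel a b y : 0 < a -> 0 < b -> 0 < y < 1 ->
  is_derive y 1 (beta_kernel a b) (rbeta_weight a b y * (a - (a + b) * y)).
Proof.
move=> a0 b0 /andP[y0 y1].
have y1' : 0 < 1 - y by rewrite subr_gt0.
have d1 := is_derive1_powR a y0.
have dlin : is_derive y 1 (fun z : R => 1 - z : R) (- 1 : R).
  by apply: is_derive_eq; rewrite add0r mul1r.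
have d2 : is_derive y 1 (fun z : R => (1 - z) `^ b)
    (b * (1 - y) `^ (b - 1) * - 1).
  apply: (@is_derive1_comp _ (fun z => z `^ b)) => //.
  exact: is_derive1_powR.
apply: (is_derive_eq (is_deriveM d1 d2)).
rewrite /GRing.scale/= /rbeta_weight.
rewrite -(mulr_powRB1 (ltW y0) a0) -(mulr_powRB1 (ltW y1') b0); ring.
Qed.

Lemma continuous_beta_kernel a b y : 0 < y < 1 ->
  {for y, continuous (beta_kernel a b)}.
Proof.
move=> /andP[y0 y1].
have y1' : 0 < 1 - y by rewrite subr_gt0.
apply: cvgM; first exact: continuous_powR.
apply: (cvg_comp (fun z => 1 - z) (fun z => z `^ b)) (continuous_powR y1').
by apply: cvgB; [exact: cvg_cst|exact: cvg_id].
Qed.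

(** For [b = 0] the second factor is constantly [1], its value at [1]
    included, so that the weight [rbeta_weight a 1] is continuous up to [1]. *)
Lemma beta_kernel_cvg_at_left1 a b : 0 <= b ->
  beta_kernel a b y @[y --> 1^'-] --> beta_kernel a b 1.
Proof.
move=> b0; apply: cvgM.
  by apply: cvg_at_left_filter; exact: continuous_powR.
have [->|bn0] := eqVneq b 0.
  by under eq_fun do rewrite powRr0; rewrite powRr0; exact: cvg_cst.
rewrite subrr powR0//.
apply: (@decreasing_cvg_at_left_comp R (fun z => 1 - z) (fun z => z `^ b)
  (BLeft 0) 1).
- by rewrite bnd_simp.
- by move=> u v _ _ uv; rewrite ltrD2l ltrN2.
- by apply: cvg_at_left_filter; apply: cvgB; [exact: cvg_cst|exact: cvg_id].
- by rewrite subrr; apply: powR_cvg0; rewrite lt0r bn0.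
Qed.

Lemma measurable_rbeta_weight a b D :
  measurable_fun D (rbeta_weight a b).
Proof.
apply: measurable_funTS; apply: measurable_funM.
  exact: measurable_powR.
apply: (measurableT_comp (measurable_powR _)).
exact: measurable_funB.
Qed.

Lemma rbeta_weight_ge0 a b x : 0 <= rbeta_weight a b x.
Proof. by rewrite mulr_ge0// powR_ge0. Qed.

Lemma rbeta_weight_le1 a b x : 1 <= a -> 1 <= b -> 0 < x < 1 ->
  rbeta_weight a b x <= 1.
Proof.
move=> a1 b1 /andP[x0 x1]; rewrite -[leRHS](mulr1 1) ler_pM ?powR_ge0//.
  by rewrite -[leRHS](powRr0 x); apply: ger_powR; [apply/andP; split|]; lra.
by rewrite -[leRHS](powRr0 (1 - x)); apply: ger_powR; [apply/andP; split|]; lra.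
Qed.

Lemma beta_kernel1 a b : 0 < b -> beta_kernel a b 1 = 0.
Proof. by move=> b0; rewrite /beta_kernel subrr powR0 ?mulr0// gt_eqF. Qed.

(** The argument behind Mills' inequality: beyond [x] the factor
    [((a + b) y - a) / ((a + b) x - a)] is at least [1], and the weight
    multiplied by it is the derivative of a multiple of the kernel, which
    vanishes at [1]. *)
Lemma integral_beta_tail_le a b x : 1 <= a -> 1 <= b ->
  0 < x < 1 -> a < (a + b) * x ->
  (\int[mu]_(y in `[x, 1%R[) (rbeta_weight a b y)%:E <=
   (beta_kernel a b x / ((a + b) * x - a))%:E)%E.
Proof.
move=> a1 b1 /andP[x0 x1] ax.
have a0 : 0 < a by lra.
have b0 : 0 < b by lra.
set m := (a + b) * x - a.
have m0 : 0 < m by rewrite subr_gt0.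
pose f y := rbeta_weight a b y * (((a + b) * y - a) / m).
have mf D : measurable_fun D f.
  apply: measurable_funM; first exact: measurable_rbeta_weight.
  by apply: measurable_funM => //; apply: measurable_funB => //;
    apply: measurable_funM.
have lef y : x <= y -> rbeta_weight a b y <= f y.
  move=> xy; rewrite ler_peMr ?rbeta_weight_ge0// ler_pdivlMr// mul1r.
  by rewrite lerB// ler_pM2l//; lra.
apply: (@le_trans _ _ (\int[mu]_(y in `[x, 1%R[) (f y)%:E)%E).
  apply: ge0_le_integral => //=.
  - by move=> y _; rewrite lee_fin rbeta_weight_ge0.
  - by apply/measurable_EFinP; exact: measurable_rbeta_weight.
  - by apply/measurable_EFinP; exact: mf.
  - by move=> y; rewrite in_itv/= => /andP[xy _]; rewrite lee_fin lef.
rewrite integral_itv_bndo_bndc; last by apply/measurable_EFinP; exact: mf.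
pose F y := - (beta_kernel a b y / m).
have itv01 y : y \in `]x, 1[ -> 0 < y < 1.
  by rewrite in_itv/= => /andP[xy ->]; rewrite (lt_trans x0 xy).
have dF y : 0 < y < 1 -> is_derive y 1 F (f y).
  move=> /(is_derive_beta_kernel a0 b0) dk.
  apply: is_derive_eq; rewrite /GRing.scale/= /f.
  by field; rewrite gt_eqF.
have cf (y : R) : ((a + b) * z - a) / m @[z --> y] --> ((a + b) * y - a) / m.
  apply: cvgMr_tmp; apply: cvgB; last exact: cvg_cst.
  by apply: cvgMl_tmp; exact: cvg_id.
rewrite (@continuous_FTC2 _ f F)//.
- by rewrite /F beta_kernel1// mul0r oppr0 sub0e -EFinN opprK.
- apply/continuous_within_itvP => //; split.
  + move=> y /itv01 y01; apply: cvgM; last exact: cf.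
    exact: continuous_beta_kernel.
  + apply: cvg_at_right_filter; apply: cvgM; last exact: cf.
    by apply: continuous_beta_kernel; rewrite x0.
  + apply: cvgM; last exact/cvg_at_left_filter/cf.
    by apply: beta_kernel_cvg_at_left1; rewrite subr_ge0.
- split.
  + by move=> y /itv01/dF [].
  + apply: cvg_at_right_filter; apply: cvgN; apply: cvgMr_tmp.
    by apply: continuous_beta_kernel; rewrite x0.
  + apply: cvgN; apply: cvgMr_tmp.
    by apply: beta_kernel_cvg_at_left1; rewrite ltW.
- by move=> y /itv01/dF dFy; rewrite derive1E derive_val.
Qed.

End beta_tail.

(** * Lower bound for the beta integral *)

Section beta_normalization.
Context {R : realType}.
Implicit Types (a b n p s x y : R).
Local Notation mu := (@lebesgue_measure R).

Lemma EFin_rbeta_fun a b : 1 <= a -> 1 <= b ->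
  ((rbeta_fun a b)%:E = \int[mu]_(x in `]0%R, 1%R[) (rbeta_weight a b x)%:E)%E.
Proof.
move=> a1 b1; rewrite fineK// ge0_fin_numE; last first.
  by apply: integral_ge0 => x _; rewrite lee_fin rbeta_weight_ge0.
apply: (@le_lt_trans _ _ (\int[mu]_(x in `]0%R, 1%R[) 1%:E)%E).
  apply: ge0_le_integral => //=.
  - by move=> x _; rewrite lee_fin rbeta_weight_ge0.
  - by apply/measurable_EFinP; exact: measurable_rbeta_weight.
  - by move=> x; rewrite in_itv/= lee_fin => /rbeta_weight_le1; exact.
rewrite integral_cst//= lebesgue_measure_itv/= lte_fin ltr01.
by rewrite sube0 mul1e ltry.
Qed.

Lemma rbeta_weight_kernel a b x : 0 < a -> 0 < b -> 0 < x < 1 ->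
  rbeta_weight a b x = beta_kernel a b x / (x * (1 - x)).
Proof.
move=> a0 b0 /andP[x0 x1]; have x1' : 0 < 1 - x by rewrite subr_gt0.
rewrite /beta_kernel -(mulr_powRB1 (ltW x0) a0) -(mulr_powRB1 (ltW x1') b0).
by rewrite /rbeta_weight; field; rewrite !gt_eqF.
Qed.

(** The integral is restricted to the interval from [p] to [p + s]. The three
    conditions on [s] make [y (1 - y)] comparable to [p (1 - p)] there, and
    make the exponent in [beta_kernel_ge] at least [- 1]. *)
Lemma rbeta_fun_ge n p s : 0 < p < 1 -> 1 <= n * p -> 1 <= n * (1 - p) ->
  0 <= s -> s <= p * (1 - p) / 2 -> n * s ^+ 2 <= p * (1 - p) / 2 ->
  s * (beta_kernel (n * p) (n * (1 - p)) p * expR (- 1) / (2 * (p * (1 - p))))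
  <= rbeta_fun (n * p) (n * (1 - p)).
Proof.
move=> /andP[p0 p1] a1 b1 s0 sp ns.
have q0 : 0 < 1 - p by rewrite subr_gt0.
have n0 : 0 < n by rewrite -(pmulr_lgt0 _ p0); lra.
have pq0 : 0 < p * (1 - p) by rewrite mulr_gt0.
have ps : s <= p / 2 by nra.
have qs : s <= (1 - p) / 2 by nra.
set m := (X in s * X).
have K0 : 0 < beta_kernel (n * p) (n * (1 - p)) p.
  by rewrite beta_kernel_gt0 ?p0.
have m0 : 0 <= m by rewrite divr_ge0// ltW// mulr_gt0 ?expR_gt0.
have mw y : p <= y <= p + s -> m <= rbeta_weight (n * p) (n * (1 - p)) y.
  move=> /andP[py ys]; have y01 : 0 < y < 1 by apply/andP; split; lra.
  rewrite rbeta_weight_kernel//; [|lra..].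
  have -> : y = p + (y - p) by rewrite subrKC.
  set u := y - p.
  have u0 : 0 <= u by rewrite subr_ge0.
  have us : u <= s by rewrite lerBlDl.
  have yy0 : 0 < (p + u) * (1 - (p + u)) by rewrite mulr_gt0//; lra.
  have yy : (p + u) * (1 - (p + u)) <= 2 * (p * (1 - p)) by nra.
  have yy2 : p * (1 - p) / 2 <= (p + u) * (1 - p - u) by nra.
  apply: ler_pM.
  - by rewrite mulr_ge0 ?expR_ge0// ltW.
  - by rewrite invr_ge0; lra.
  - have uq : 0 <= u < 1 - p by apply/andP; split; lra.
    apply: le_trans (beta_kernel_ge n0 p0 uq).
    rewrite ler_pM2l// ler_expR lerN2.
    rewrite ler_pdivrMr ?mul1r; last by lra.
    apply: le_trans yy2; apply: le_trans ns.
    by rewrite ler_pM2l// ler_sqr ?nnegrE.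
  - by rewrite lef_pV2 ?posrE//; lra.
rewrite -lee_fin EFin_rbeta_fun//.
apply: (@le_trans _ _ (\int[mu]_(y in `[p, (p + s)%R])
    (rbeta_weight (n * p) (n * (1 - p)) y)%:E)%E); last first.
  apply: ge0_subset_integral => //=.
  - by apply/measurable_EFinP; exact: measurable_rbeta_weight.
  - by move=> y _; rewrite lee_fin rbeta_weight_ge0.
  - move=> y/=; rewrite !in_itv/= => /andP[py ys]; apply/andP; split; lra.
apply: (@le_trans _ _ (\int[mu]_(y in `[p, (p + s)%R]) m%:E)%E).
  rewrite integral_cst//= lebesgue_measure_itv/= lte_fin ltrDl.
  case: ifPn => [_|]; first by rewrite -EFinB addrAC subrr add0r -EFinM mulrC.
  by rewrite -leNgt => s0'; rewrite mule0 lee_fin mulr_le0_ge0.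
apply: ge0_le_integral => //=.
by apply/measurable_EFinP; exact: measurable_rbeta_weight.
Qed.

(** An elementary Stirling bound, from [rbeta_fun_ge] with
    [s = sqrt (p (1 - p) / n) / 4]. The hypotheses on [n p] and [n (1 - p)] give
    [n p (1 - p) >= 1/2], which makes this [s] at most [p (1 - p) / 2]. *)
Lemma rbeta_fun_ge_stddev n p : 0 < p < 1 -> 1 <= n * p -> 1 <= n * (1 - p) ->
  beta_kernel (n * p) (n * (1 - p)) p <=
  16 * expR 1 * n * Num.sqrt (p * (1 - p) / (n + 1)) *
  rbeta_fun (n * p) (n * (1 - p)).
Proof.
move=> p01 a1 b1; have /andP[p0 p1] := p01.
have q0 : 0 < 1 - p by rewrite subr_gt0.
have pq0 : 0 < p * (1 - p) by rewrite mulr_gt0.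
have n2 : 2 <= n by lra.
have npq : 1 / 2 <= n * (p * (1 - p)).
  (* Expanded, [nn] says that [n ^+ 2 * (p * (1 - p)) >= n - 1 >= n / 2]. *)
  have nn : 0 <= (n * p - 1) * (n * (1 - p) - 1) by rewrite mulr_ge0//; lra.
  by rewrite -(@ler_pM2l _ n); nra.
set t := Num.sqrt (p * (1 - p) / n).
have t2 : n * t ^+ 2 = p * (1 - p).
  rewrite sqr_sqrtr; last by rewrite divr_ge0//; lra.
  by field; apply: lt0r_neq0; lra.
have t0 : 0 <= t by rewrite sqrtr_ge0.
set sigma := Num.sqrt _.
(* [n + 1 <= 4 n] compares the variance, which has [n + 1] in its denominator,
   with [t ^+ 2], which has [n]. *)
have ts : t / 2 <= sigma.
  rewrite -[leLHS]ger0_norm ?divr_ge0// -sqrtr_sqr ler_wsqrtr//.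
  rewrite ler_pdivlMr; last lra.
  rewrite expr_div_n; nra.
have tpq : t / 4 <= p * (1 - p) / 2.
  rewrite -ler_sqr ?nnegrE ?divr_ge0//; [|lra..].
  rewrite -(@ler_pM2l _ n); last lra.
  by rewrite !expr_div_n mulrA t2; nra.
have nt : n * (t / 4) ^+ 2 <= p * (1 - p) / 2.
  by rewrite expr_div_n mulrA t2; lra.
have t40 : 0 <= t / 4 by rewrite divr_ge0.
have := rbeta_fun_ge p01 a1 b1 t40 tpq nt.
set K := beta_kernel _ _ _; set B := rbeta_fun _ _.
have K0 : 0 < K by rewrite beta_kernel_gt0.
move=> KB.
have e1 : expR 1 * expR (-1) = 1 :> R by rewrite -expRD subrr expR0.
have -> : K = 16 * expR 1 * n * (t / 2) *
    (t / 4 * (K * expR (-1) / (2 * (p * (1 - p))))).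
  transitivity (K * (expR 1 * expR (-1)) * (n * t ^+ 2) / (p * (1 - p))).
    by rewrite e1 t2 mulr1 mulfK// gt_eqF.
  by field; do ?[apply/andP; split]; apply: lt0r_neq0; lra.
apply: ler_pM => //.
- by rewrite !mulr_ge0 ?expR_ge0// ?divr_ge0//; lra.
- by rewrite mulr_ge0// divr_ge0// ltW// mulr_gt0 ?expR_gt0.
- by rewrite ler_pM2l// !mulr_gt0 ?expR_gt0//; lra.
Qed.

Lemma rbeta_fun_gt0 n p : 0 < p < 1 -> 1 <= n * p -> 1 <= n * (1 - p) ->
  0 < rbeta_fun (n * p) (n * (1 - p)).
Proof.
move=> p01 a1 b1; have := rbeta_fun_ge_stddev p01 a1 b1.
move/(lt_le_trans (beta_kernel_gt0 _ _ p01)); rewrite pmulr_rgt0//.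
have /andP[p0 p1] := p01.
rewrite !mulr_gt0 ?expR_gt0 ?sqrtr_gt0 ?divr_gt0 ?mulr_gt0//; lra.
Qed.

End beta_normalization.

(** * Tail probabilities *)

Section beta_mills.
Context {R : realType}.
Implicit Types (a b n p u x : R).
Local Notation mu := (@lebesgue_measure R).

Lemma rbeta_prob_tail a b x : 0 < x -> 0 < rbeta_fun a b ->
  (rbeta_prob a b [set` `[x, +oo[] =
   \int[mu]_(y in `[x, 1%R[) (rbeta_weight a b y)%:E * (rbeta_fun a b)^-1%:E)%E.
Proof.
move=> x0 B0; rewrite /rbeta_prob.
have -> : [set` `[x, 1[] = [set` `[x, +oo[] `&` [set` `]0, 1[].
  apply/seteqP; split => y /=; rewrite !in_itv/= ?andbT.
    by move=> /andP[xy ->]; rewrite xy (lt_le_trans x0 xy).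
  by move=> [-> /andP[_ ->]].
rewrite -ge0_integralZr//=; last 4 first.
- exact: measurableI.
- by apply/measurable_EFinP; exact: measurable_rbeta_weight.
- by move=> y _; rewrite lee_fin rbeta_weight_ge0.
- by rewrite lee_fin invr_ge0 ltW.
rewrite [RHS]integral_mkcondr/=; apply: eq_integral => y _ /=.
by rewrite /rbeta_pdf !patchE; case: ifPn.
Qed.

(** The prefactor, of order [sigma / u] as for a Gaussian variable of standard
    deviation [sigma], is what pays for replacing [n] by [n + d] in the exponent
    when [u] is a large multiple of [sigma]. *)
Lemma rbeta_prob_tail_le n p u : 0 < p < 1 -> 1 <= n * p -> 1 <= n * (1 - p) ->
  0 < u < 1 - p ->
  (rbeta_prob (n * p) (n * (1 - p)) [set` `[(p + u)%R, +oo[] <=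
   (16 * expR 1 * Num.sqrt (p * (1 - p) / (n + 1)) / u *
    expR (- (n * u ^+ 2 / (2 * (p + 2 * u / 3) * (1 - p - 2 * u / 3)))))%:E)%E.
Proof.
move=> p01 a1 b1 /andP[u0 uq]; have /andP[p0 p1] := p01.
have n0 : 0 < n by lra.
have B0 := rbeta_fun_gt0 p01 a1 b1.
have KB := rbeta_fun_ge_stddev p01 a1 b1.
have Ku : 0 <= u < 1 - p by rewrite ltW.
have {Ku} := beta_kernel_le n0 p0 Ku.
set E := expR _ => KE.
have x0 : 0 < p + u by lra.
have x01 : 0 < p + u < 1 by apply/andP; split; lra.
rewrite rbeta_prob_tail//.
have ax : n * p < (n * p + n * (1 - p)) * (p + u) by nra.
have iB0 : (0 <= (rbeta_fun (n * p) (n * (1 - p)))^-1%:E)%E.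
  by rewrite lee_fin invr_ge0 ltW.
apply: (le_trans (lee_wpmul2r iB0 (integral_beta_tail_le a1 b1 x01 ax))).
rewrite -EFinM lee_fin ler_pdivrMr// ler_pdivrMr ?subr_gt0//.
apply: (le_trans KE).
set B := rbeta_fun _ _ in B0 KB *; set sigma := Num.sqrt _ in KB *.
have -> : 16 * expR 1 * sigma / u * E * B *
    ((n * p + n * (1 - p)) * (p + u) - n * p) =
    16 * expR 1 * n * sigma * B * E.
  by field; rewrite gt_eqF.
by rewrite ler_pM2r// expR_gt0.
Qed.

End beta_mills.

(** * The Bernstein-type inequality *)

(* The quotient is taken in [\bar R], where [0%:E^-1 = +oo] and
   [expeR -oo = 0]. *)
Theorem corollary3p7 (R : realType) (d : R) (d_gt0 : 0 < d) :
  exists c : R, 0 < c /\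
    forall (a b : R), 1 <= a -> 1 <= b ->
    let p := beta_mean a b in
    forall (disp : measure_display) (T : measurableType disp)
      (P : probability T R) (X : {RV P >-> R}),
    has_beta_distribution P X a b ->
    forall eps : R, c * beta_stddev a b <= eps ->
    (P [set w | (X w - p >= eps)%R] <=
      expeR (- (((a + b + d) * eps ^+ 2)%:E /
                (2 * (p + 2 * eps / 3)
                   * pos_part (1 - p - 2 * eps / 3))%:E)))%E.
Proof.
exists (16 * expR (1 + 9 / 4 * d)); split; first by rewrite mulr_gt0 ?expR_gt0.
move=> a b a1 b1 p disp T P X Xbeta eps; rewrite /beta_stddev -/p.
set n := a + b => ceps.
have n0 : 0 < n by rewrite /n; lra.
have aE : a = n * p by rewrite /p /beta_mean -/n mulrC divfK// gt_eqF.
have bE : b = n * (1 - p) by rewrite mulrBr mulr1 -aE /n addrAC subrr add0r.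
have p0 : 0 < p by rewrite divr_gt0//; lra.
have p1 : p < 1 by rewrite ltr_pdivrMr// /n; lra.
have p01 : 0 < p < 1 by rewrite p0.
have q0 : 0 < 1 - p by rewrite subr_gt0.
have a1' : 1 <= n * p by rewrite -aE.
have b1' : 1 <= n * (1 - p) by rewrite -bE.
set sigma := Num.sqrt _ in ceps.
have pq0 : 0 < p * (1 - p) by rewrite mulr_gt0.
have sigma0 : 0 < sigma by rewrite sqrtr_gt0 divr_gt0//; lra.
have eps0 : 0 < eps.
  by apply: lt_le_trans ceps; rewrite mulr_gt0// mulr_gt0 ?expR_gt0.
have -> : P [set w | (X w - p >= eps)%R] =
    rbeta_prob (n * p) (n * (1 - p)) [set` `[(p + eps)%R, +oo[].
  rewrite -aE -bE -Xbeta//; congr (P _); apply/seteqP; split => w /=;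
    by rewrite in_itv/= andbT lerBrDl.
(* If [1 <= p + eps], the tail lies where the density vanishes. *)
have [qeps|epsq] := leP (1 - p) eps.
  rewrite rbeta_prob_tail ?rbeta_fun_gt0//; last lra.
  rewrite set_itv_ge; last by rewrite bnd_simp -leNgt; lra.
  by rewrite integral_set0 mul0e expeR_ge0.
have u01 : 0 < eps < 1 - p by rewrite eps0.
apply: (le_trans (rbeta_prob_tail_le p01 a1' b1' u01)).
have v0 : 0 < 1 - p - 2 * eps / 3 by lra.
rewrite /pos_part max_l; last exact: ltW.
set D := 2 * (p + 2 * eps / 3) * (1 - p - 2 * eps / 3).
have D0 : 0 < D by rewrite !mulr_gt0//; lra.
rewrite inver gt_eqF// -EFinM -EFinN /= lee_fin.
have eD : eps ^+ 2 / D <= 9 / 4.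
  have le_factors : (2 * eps / 3) * (eps / 3) <=
      (p + 2 * eps / 3) * (1 - p - 2 * eps / 3) by apply: ler_pM; lra.
  by rewrite ler_pdivrMr// /D -(mulrA 2); lra.
have -> : - ((n + d) * eps ^+ 2 / D) =
    - (d * (eps ^+ 2 / D)) - n * eps ^+ 2 / D.
  by field; rewrite gt_eqF.
rewrite expRD ler_pM2r ?expR_gt0// -/sigma.
apply: (@le_trans _ _ (expR (- (9 / 4 * d)))); last first.
  by rewrite ler_expR lerN2 mulrC ler_pM2r.
rewrite ler_pdivrMr// expRN ler_pdivlMl ?expR_gt0//.
by apply: le_trans ceps; rewrite expRD; lra.
Qed.
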